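(* Let $\varphi$ be the morphism on the alphabet $\{0, 1, 0', -1\}$ defined by $$0 \mapsto 0\,1\,0'\,{-1},\quad 1 \mapsto 0\,1\,{-1}\,1,\quad 0' \mapsto 0'\,{-1}\,0\,1,\quad {-1} \mapsto 0'\,{-1}\,1\,{-1},$$ and let $\tau$ be the letter-to-letter map (coding) with $\tau(0)=\tau(0')=0$, $\tau(1)=1$, $\tau(-1)=-1$. Let $\varphi^\omega(0)$ be the infinite fixed point of $\varphi$ starting with $0$, and $\mathbf{w} = \tau(\varphi^\omega(0))$, an infinite word over $\{-1,0,1\} \subset \mathbb{Z}$. Then $\mathbf{w}$ is squarefree (contains no factor $xx$ with $x$ nonempty), and $\mathbf{w}$ contains no factor of the form $x x'$ (with $x, x'$ words of arbitrary, possibly different, lengths) such that $\sum x = \sum x' \neq 0$.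
   Context: For a word $x$ over $\mathbb{Z}$, $\sum x$ denotes the sum of its entries. A factor of $\mathbf{w}$ is a contiguous block of consecutive letters. *)

(* Defs.v *)
From mathcomp Require Import all_boot all_order all_algebra.

Set Implicit Arguments.
Unset Strict Implicit.
Unset Printing Implicit Defensive.

Import GRing.Theory.

(* L0' is the letter 0' and Lm1 is the letter -1. *)
Inductive letter : Type := L0 | L1 | L0' | Lm1.

Definition phi (a : letter) : seq letter :=
  match a with
  | L0  => [:: L0; L1; L0'; Lm1]
  | L1  => [:: L0; L1; Lm1; L1]
  | L0' => [:: L0'; Lm1; L0; L1]
  | Lm1 => [:: L0'; Lm1; L1; Lm1]
  end.

Definition phi_word (s : seq letter) : seq letter := flatten (map phi s).

(* Each phi^n(0) is a prefix of phi^(n+1)(0) and has length 4^n > n, so the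
   letter of index n of the limit can be read off phi^n(0); see phi_omega_prefix
   and phi_omega_fixed below. *)
Definition phi_omega (n : nat) : letter := nth L0 (iter n phi_word [:: L0]) n.

Definition tau (a : letter) : int :=
  match a with
  | L0 | L0' => 0%R
  | L1 => 1%R
  | Lm1 => (-1)%R
  end.

Definition w (n : nat) : int := tau (phi_omega n).

Definition factor (T : Type) (f : seq T) (u : nat -> T) : Prop :=
  exists i : nat, f = mkseq (fun k => u (i + k)) (size f).

Definition squarefree (T : Type) (u : nat -> T) : Prop :=
  forall x : seq T, factor (x ++ x) u -> x = [::].

Definition wsum (x : seq int) : int := (\sum_(a <- x) a)%R.

Lemma phi_word_cat s t : phi_word (s ++ t) = phi_word s ++ phi_word t.
Proof. by rewrite /phi_word map_cat flatten_cat. Qed.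

Lemma size_phi_word s : size (phi_word s) = 4 * size s.
Proof.
elim: s => [|a s IH] //.
by rewrite -cat1s phi_word_cat !size_cat IH mulnDr; case: a.
Qed.

Lemma size_iter_phi n : size (iter n phi_word [:: L0]) = 4 ^ n.
Proof. by elim: n => [|n IH] //=; rewrite size_phi_word IH expnS. Qed.

Lemma iter_phi_prefix m n : m <= n ->
  exists t, iter n phi_word [:: L0] = iter m phi_word [:: L0] ++ t.
Proof.
move=> /subnKC <-; elim: (n - m) => [|d [t IH]].
  by exists [::]; rewrite addn0 cats0.
have [t' Ht'] : exists t',
    iter m.+1 phi_word [:: L0] = iter m phi_word [:: L0] ++ t'.
  elim: m {IH t} => [|m [t' IH]]; first by exists [:: L1; L0'; Lm1].
  by exists (phi_word t'); rewrite iterS {1}IH phi_word_cat.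
exists (t' ++ phi_word t); rewrite addnS iterS IH phi_word_cat.
by rewrite -iterS Ht' catA.
Qed.

Lemma phi_omega_prefix n : iter n phi_word [:: L0] = mkseq phi_omega (4 ^ n).
Proof.
apply: (@eq_from_nth _ L0) => [|i]; rewrite size_iter_phi ?size_mkseq // => Hi.
rewrite nth_mkseq // /phi_omega.
have lt4 : i < 4 ^ i by apply: ltn_expl.
case: (leqP n i) => [|/ltnW] /iter_phi_prefix [t ->].
  by rewrite nth_cat size_iter_phi Hi.
by rewrite nth_cat size_iter_phi lt4.
Qed.

Lemma phi_omega_fixed n :
  phi_word (mkseq phi_omega n) = mkseq phi_omega (4 * n).
Proof.
have take_mk m k : m <= k -> mkseq phi_omega m = take m (mkseq phi_omega k).
  by move=> le_mk; rewrite /mkseq -map_take take_iota (minn_idPl le_mk).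
have lt4 : n < 4 ^ n by apply: ltn_expl.
have := congr1 phi_word (phi_omega_prefix n).
rewrite -iterS phi_omega_prefix -{1}(cat_take_drop n (mkseq phi_omega (4 ^ n))).
rewrite -(take_mk _ _ (ltnW lt4)) phi_word_cat => E.
have le4 : 4 * n <= 4 ^ n.+1 by rewrite expnS leq_mul2l ltnW.
by rewrite (take_mk _ _ le4) E take_size_cat // size_phi_word size_mkseq.
Qed.

(* Main.v *)
Require Import Defs.
From mathcomp Require Import all_boot all_order all_algebra.
From mathcomp Require Import zify.

Set Implicit Arguments.
Unset Strict Implicit.
Unset Printing Implicit Defensive.

Import GRing.Theory.

(** In the fixed point [u = phi_omega] a letter is followed only as in
    0 -> 1, 1 -> 0' or -1, 0' -> -1, -1 -> 0 or 1. Hence the partial sums of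
    [w] take only the values 0 and 1: the sum of [w] before position [n] is 0 if
    [u n] is 0 or 1, and 1 if [u n] is 0' or -1. So the sum of any factor lies in
    {-1, 0, 1}, and [x x'] with equal nonzero sums would have a sum of absolute
    value at least 2. For a square [x x] in [w] this forces [x] to have sum 0, so
    both copies of [x] start at the same partial sum and the square lifts to a
    square of [u].

    A square of [u] of period [p] is excluded by descent. The third letter of
    [phi a] determines [a], so if 4 divides [p] then sampling at the positions
    congruent to 2 mod 4 gives a square of period [p / 4]. If 4 does not divide
    [p], comparing letters at positions in different classes mod 4 gives a
    contradiction: odd positions carry only 1 and -1, positions divisible
    by 4 carry only 0 and 0', and a position [4 n + 2] carries 0 or 0' only when
    [u n] is 0 or 0'. *)

Definition follows (a b : letter) : bool :=
  match a, b with
  | L0, L1 | L1, L0' | L1, Lm1 | L0', Lm1 | Lm1, L0 | Lm1, L1 => true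
  | _, _ => false
  end.

Definition nonzero_letter (a : letter) : bool :=
  match a with L1 | Lm1 => true | _ => false end.

(* The partial sum of [w] before an occurrence of the letter. *)
Definition level (a : letter) : int :=
  match a with L0 | L1 => 0%R | L0' | Lm1 => 1%R end.

Lemma phi_omega_block n j :
  j < 4 -> phi_omega (4 * n + j) = nth L0 (phi (phi_omega n)) j.
Proof.
move=> lt_j4; have lt_jn : 4 * n + j < 4 * n.+1 by lia.
rewrite -(nth_mkseq L0 phi_omega lt_jn) -phi_omega_fixed.
rewrite /mkseq -addn1 iotaD map_cat phi_word_cat nth_cat.
rewrite size_phi_word size_map size_iota ltnNge leq_addr /= addKn.
by rewrite /phi_word /= cats0.
Qed.

Lemma phi_omega_follows n : follows (phi_omega n) (phi_omega n.+1).
Proof.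
elim/ltn_ind: n => n IH.
have -> : n = 4 * (n %/ 4) + n %% 4 by lia.
have lt_n4 : n %% 4 < 4 by rewrite ltn_mod.
have [lt_n3 | ge_n3] := ltnP (n %% 4) 3.
  rewrite -addnS !phi_omega_block //.
  by move: (n %% 4) lt_n3 => [|[|[|//]]] _; case: (phi_omega _).
(* At a block boundary the pair depends only on the letters at [n %/ 4] and its successor, to which
   induction applies. *)
have -> : n %% 4 = 3 by lia.
have -> : (4 * (n %/ 4) + 3).+1 = 4 * (n %/ 4).+1 + 0 by lia.
have := IH (n %/ 4); rewrite !phi_omega_block //.
have -> : n %/ 4 < n by lia.
by move=> /(_ isT); case: (phi_omega _); case: (phi_omega _).
Qed.

Lemma nonzero_letter_odd n : odd n -> nonzero_letter (phi_omega n).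
Proof.
move=> odd_n; have -> : n = 4 * (n %/ 4) + n %% 4 by lia.
rewrite phi_omega_block ?ltn_mod //.
have [->|->] : n %% 4 = 1 \/ n %% 4 = 3 by lia.
  by case: (phi_omega _).
by case: (phi_omega _).
Qed.

Lemma nonzero_letter_mul4 n : ~~ nonzero_letter (phi_omega (4 * n)).
Proof. by rewrite -[4 * n]addn0 phi_omega_block //; case: (phi_omega _). Qed.

Lemma nonzero_letter_mul4_add2 n :
  nonzero_letter (phi_omega (4 * n + 2)) = nonzero_letter (phi_omega n).
Proof. by rewrite phi_omega_block //; case: (phi_omega _). Qed.

Lemma phi_omega_mul4_add2_inj m n :
  phi_omega (4 * m + 2) = phi_omega (4 * n + 2) -> phi_omega m = phi_omega n.
Proof.
by rewrite !phi_omega_block //; case: (phi_omega _); case: (phi_omega _).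
Qed.

Definition square_at (T : Type) (u : nat -> T) (i p : nat) : Prop :=
  forall k, k < p -> u (i + k) = u (i + k + p).

Lemma square_at_partner (T : Type) (u : nat -> T) i p m :
  square_at u i p -> i <= m < i + 2 * p ->
  exists2 m', m' = m + p \/ m = m' + p & u m = u m'.
Proof.
move=> sq /andP[le_im lt_m].
have [lt_mp | ge_mp] := ltnP m (i + p).
  exists (m + p); first by left.
  by have := sq (m - i); rewrite subnKC //; apply; lia.
exists (m - p); first by right; lia.
have := sq (m - p - i); rewrite subnKC ?subnK; try lia.
by move=> -> //; lia.
Qed.

(** A window of length 4 is too short for the general argument, but it lies in two consecutive
    blocks: a finite check. *)
Lemma phi_omega_no_square2 i : ~ square_at phi_omega i 2.
Proof.
move=> sq; have := sq 0 isT; have := sq 1 isT; rewrite addn0.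
have -> : i = 4 * (i %/ 4) + i %% 4 by lia.
have lt_i4 : i %% 4 < 4 by rewrite ltn_mod.
have := phi_omega_follows (i %/ 4).
have block j : j < 8 -> phi_omega (4 * (i %/ 4) + j) =
    nth L0 (phi (phi_omega (i %/ 4)) ++ phi (phi_omega (i %/ 4).+1)) j.
  have -> (a : letter) t : nth L0 (phi a ++ t) j =
      if j < 4 then nth L0 (phi a) j else nth L0 t (j - 4).
    by rewrite nth_cat; case: a.
  move=> lt_j8; case: ltnP => [lt_j4 | ge_j4]; first exact: phi_omega_block.
  by rewrite -phi_omega_block; [congr phi_omega|]; lia.
rewrite -!(addnA (4 * _)); move: (i %% 4) lt_i4 => [|[|[|[|//]]]] _;
  rewrite !block //;
  by case: (phi_omega _); case: (phi_omega _).
Qed.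

Lemma phi_omega_no_square p i : 0 < p -> ~ square_at phi_omega i p.
Proof.
elim/ltn_ind: p i => p IH i p_gt0 sq.
have [odd_p | even_p] := boolP (odd p).
  have [p1 | p_neq1] := eqVneq p 1.
    move: sq (phi_omega_follows i); rewrite p1 => /(_ 0 isT).
    by rewrite addn0 addn1 => <-; case: (phi_omega i).
  (* The least multiple of 4 from [i] on; its partner is odd. *)
  have in_window : i <= 4 * ((i + 3) %/ 4) < i + 2 * p by lia.
  have [m' m'E eq_m'] := square_at_partner sq in_window.
  have := nonzero_letter_mul4 ((i + 3) %/ 4).
  by rewrite eq_m' nonzero_letter_odd //; lia.
have [dvd4 | ndvd4] := boolP (4 %| p).
  (* [(i + 1) %/ 4] is the least [n] with [i <= 4 * n + 2]. *)
  apply: (IH (p %/ 4) _ ((i + 1) %/ 4)); try lia.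
  move=> k lt_k; apply: phi_omega_mul4_add2_inj.
  have := sq (4 * ((i + 1) %/ 4 + k) + 2 - i).
  rewrite subnKC; last by lia.
  by move=> ->; [congr phi_omega|]; lia.
have [p2 | p_neq2] := eqVneq p 2.
  by move: sq; rewrite p2; apply: phi_omega_no_square2.
(* Now [p] is 2 mod 4, so the partner of [4 * n + 2] is a multiple of 4. *)
have zero n : i <= 4 * n + 2 < i + 2 * p -> ~~ nonzero_letter (phi_omega n).
  move=> in_window; have [m' m'E eq_m'] := square_at_partner sq in_window.
  rewrite -nonzero_letter_mul4_add2 eq_m'.
  have -> : m' = 4 * (m' %/ 4) by lia.
  exact: nonzero_letter_mul4.
(* As [p >= 6], [zero] applies to two adjacent letters, which [follows] forbids. *)
have := phi_omega_follows ((i + 1) %/ 4).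
have := zero ((i + 1) %/ 4); have := zero ((i + 1) %/ 4).+1.
have -> : i <= 4 * ((i + 1) %/ 4) + 2 < i + 2 * p by lia.
have -> : i <= 4 * ((i + 1) %/ 4).+1 + 2 < i + 2 * p by lia.
move=> /(_ isT) + /(_ isT).
by case: (phi_omega _); case: (phi_omega _).
Qed.

Lemma level_succ n :
  level (phi_omega n.+1) = (level (phi_omega n) + w n)%R.
Proof.
rewrite /w; have := phi_omega_follows n.
by case: (phi_omega n); case: (phi_omega n.+1).
Qed.

Lemma wsum_window i n :
  wsum (mkseq (fun k => w (i + k)) n) =
  (level (phi_omega (i + n)) - level (phi_omega i))%R.
Proof.
rewrite /wsum; elim: n => [|n IH]; first by rewrite big_nil addn0 subrr.
rewrite /mkseq -addn1 iotaD map_cat big_cat /= IH big_seq1 add0n.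
by rewrite addn1 addnS level_succ addrAC.
Qed.

Lemma factor_catP (T : Type) (x y : seq T) (u : nat -> T) :
  factor (x ++ y) u ->
  exists i, x = mkseq (fun k => u (i + k)) (size x) /\
            y = mkseq (fun k => u (i + size x + k)) (size y).
Proof.
case=> i; rewrite size_cat /mkseq iotaD map_cat => E; exists i.
have szE : size x = size (map (fun k => u (i + k)) (iota 0 (size x))).
  by rewrite size_map size_iota.
split; first by rewrite -[LHS](take_size_cat y erefl) E take_size_cat.
rewrite -[LHS](drop_size_cat y (erefl (size x))) E drop_size_cat //.
rewrite add0n -[in LHS](addn0 (size x)) iotaDl -map_comp.
by apply: eq_map => k /=; rewrite addnA.
Qed.

Lemma factor_wsum_eq0 x x' :
  factor (x ++ x') w -> wsum x = wsum x' -> wsum x = 0%R.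
Proof.
case/factor_catP=> i [xE x'E]; rewrite xE x'E !wsum_window.
by do 3!case: (phi_omega _).
Qed.

Lemma squarefree_w : squarefree w.
Proof.
move=> x xx; have sum0 := factor_wsum_eq0 xx erefl.
have [i [xE xE']] := factor_catP xx.
apply: size0nil; have [//|p_gt0] := posnP (size x).
case: (@phi_omega_no_square (size x) i p_gt0).
have sq_w : square_at w i (size x).
  move=> k lt_k; have := congr1 (fun s => nth 0%R s k) xE'.
  by rewrite {1}xE !nth_mkseq // addnAC.
have sq_level k : k <= size x ->
    level (phi_omega (i + k)) = level (phi_omega (i + k + size x)).
  elim: k => [_|k IH lt_k].
    by move: sum0; rewrite addn0 xE wsum_window -xE => /subr0_eq.
  by rewrite addnS addSn !level_succ sq_w // IH // ltnW.
(* A letter is determined by its [level] and its [tau]. *)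
move=> k lt_k; have := sq_level k (ltnW lt_k); have := sq_w k lt_k.
by rewrite /w; case: (phi_omega _); case: (phi_omega _).
Qed.

Theorem theorem5 :
  squarefree w /\
  ~ (exists x x' : seq int,
       factor (x ++ x') w /\ wsum x = wsum x' /\ wsum x <> 0%R).
Proof.
split; first exact: squarefree_w.
by move=> [x [x' [xx' [eq_sum]]]]; apply; apply: factor_wsum_eq0 eq_sum.
Qed.
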